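(* Let $\mathcal{C}=\langle(x^n-\lambda_0)^\nu\rangle$ be a $\lambda$-constacyclic code of length $np^s$ over $\mathcal{R}_e$, where $0\le\nu\le ep^s$. For $0\le\rho\le np^s$, let $\mathcal{A}_\rho$ denote the number of codewords in $\mathcal{C}$ having RT weight $\rho$. (a) For $\nu=ep^s$: $\mathcal{A}_\rho=1$ if $\rho=0$, and $\mathcal{A}_\rho=0$ otherwise. (b) For $(e-1)p^s+1\le\nu\le ep^s-1$: $$\mathcal{A}_\rho=\begin{cases} 1&\text{if }\rho=0; \\ 0&\text{if }1\le\rho\le n\nu-n(e-1)p^s; \\ (p^m-1)p^{m(\rho-n\nu+n(e-1)p^s-1)}&\text{if }n\nu-n(e-1)p^s+1\le\rho\le np^s.\end{cases}$$ (c) For $\nu=yp^s$ with $0\le y\le e-1$: $$\mathcal{A}_\rho=\begin{cases} 1&\text{if }\rho=0; \\ (p^{m(e-y)}-1)p^{m(e-y)(\rho-1)}&\text{if }1\le\rho\le np^s.\end{cases}$$ (d) For $(b-1)p^s+1\le\nu\le bp^s-1$ with $1\le b\le e-1$: $$\mathcal{A}_\rho=\begin{cases} 1&\text{if }\rho=0; \\ (p^{m(e-b)}-1)p^{m(e-b)(\rho-1)}&\text{if }1\le\rho\le n\nu-n(b-1)p^s; \\ p^{m(np^s(b-1)-n\nu-e+b-1)}(p^{m(e-b+1)}-1)p^{m(e-b+1)\rho}&\text{if }n\nu-n(b-1)p^s+1\le\rho\le np^s.\end{cases}$$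
   Context: $e\ge2$ is an integer and $\mathcal{R}_e$ is a finite commutative chain ring with unity, with maximal ideal $\langle\gamma\rangle$ where $\gamma$ has nilpotency index $e$; its residue field $\mathcal{R}_e/\langle\gamma\rangle$ has order $p^m$, $p$ prime. $\zeta\in\mathcal{R}_e$ has multiplicative order $p^m-1$ and $\mathcal{T}_e=\{0,1,\zeta,\dots,\zeta^{p^m-2}\}$. $n,s$ are positive integers with $\gcd(n,p)=1$. $\lambda=\lambda_0^{p^s}+\gamma\omega$ is a unit of $\mathcal{R}_e$, where $\lambda_0\in\mathcal{T}_e\setminus\{0\}$ is such that $x^n-\lambda_0$ is irreducible over $\mathcal{R}_e$, and $\omega$ is a unit in $\mathcal{R}_e$. $\lambda$-constacyclic codes of length $np^s$ over $\mathcal{R}_e$ are identified with ideals of $\mathcal{R}_e[x]/\langle x^{np^s}-\lambda\rangle$, whose elements are represented by polynomials of degree less than $np^s$. The Rosenbloom-Tsfasman (RT) weight is $w_{RT}(c(x))=1+\deg c(x)$ if $c(x)\neq0$ and $w_{RT}(0)=0$. *)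

(* Defs.v *)
From mathcomp Require Export all_boot all_order all_algebra.
Set Implicit Arguments.
Unset Strict Implicit.
Unset Printing Implicit Defensive.
Import GRing.Theory.
Local Open Scope ring_scope.

Definition principal_ideal (A : finComNzRingType) (g : A) : {set A} :=
  [set a * g | a : A].

(* [idealr_closed] describes proper ideals; comparing these is enough for all
   ideals to form a chain, since the whole ring contains every ideal. *)
Definition chain_ring (A : finComNzRingType) : Prop :=
  forall I J : {set A}, idealr_closed I -> idealr_closed J ->
    (I \subset J) || (J \subset I).

Definition maximal_ideal (A : finComNzRingType) (M : {set A}) : Prop :=
  idealr_closed M /\
  forall J : {set A}, idealr_closed J -> M \subset J -> J = M.

Definition cosets (A : finComNzRingType) (I : {set A}) : {set {set A}} :=
  [set [set x + a | a in I] | x : A].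

Definition nilpotency_index (A : comNzRingType) (g : A) (e : nat) : Prop :=
  g ^+ e = 0 /\ forall k, (k < e)%N -> g ^+ k != 0.

(* [A] need not be a domain, so the library provides no unit predicate on
   {poly A}, and invertible polynomials may be nonconstant. *)
Definition poly_unit (A : comNzRingType) (f : {poly A}) : Prop :=
  exists g, f * g = 1.

Definition poly_irreducible (A : comNzRingType) (f : {poly A}) : Prop :=
  ~ poly_unit f /\ forall g h, f = g * h -> poly_unit g \/ poly_unit h.

(* [q] is the number of elements of the residue field. *)
Definition teichmuller (A : finComNzRingType) (q : nat) (zeta : A) : {set A} :=
  0 |: [set zeta ^+ i | i : 'I_q.-1].

(* For [N > 0] the modulus is monic of degree [N], so {poly %/ _} is the
   quotient of {poly A} by it, with representatives of degree less than [N]. *)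
Notation ambient N lambda := {poly %/ ('X^N - lambda%:P)} (only parsing).

(* Constacyclic codes of length [N] are identified with ideals of [ambient];
   this is the principal ideal generated by the class of [f]. *)
Definition constacyclic_code (A : finComUnitRingType) (N : nat) (lambda : A)
    (f : {poly A}) : {set ambient N lambda} :=
  [set a * in_qpoly _ f | a : ambient N lambda].

(* [size] is 0 on the zero polynomial and [1 + degree] elsewhere. *)
Definition RT_weight (A : finComUnitRingType) (N : nat) (lambda : A)
    (c : ambient N lambda) : nat :=
  size (c : {poly A}).

Definition RT_count (A : finComUnitRingType) (N : nat) (lambda : A)
    (C : {set ambient N lambda}) (rho : nat) : nat :=
  #|[set c in C | RT_weight c == rho]|.

(* Main.v *)
Require Import Defs.
From mathcomp Require Import qpoly ring zify.
Import GRing.Theory.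
Import Pdiv.CommonRing Pdiv.RingMonic.
Local Open Scope ring_scope.
Set Implicit Arguments.
Unset Strict Implicit.
Unset Printing Implicit Defensive.

(** Put g = x^n - lambda0, P = p^s, q = p^m, and let h = x^(n P) - lambda be the
    modulus.  In the binomial expansion of (lambda0 + g)^P every middle
    coefficient is a multiple of p, hence of gamma, and every middle monomial
    is a multiple of g.  So g^P = h + gamma w with w = omega - c g K
    ([base_primeX]): modulo h, g^P is gamma times w, and g is therefore
    nilpotent, which makes w an invertible element (omega plus a nilpotent).
    In the quotient ring, gamma and g^P thus generate the same ideal.

    Write nu = y P + t with t <= P.  The code generated by g^nu is then
    generated by gamma^y g^t, and it contains gamma^(y+1).  Consequently a
    polynomial c of degree less than n P represents a codeword exactly when,
    in the division c = Q g^t + r by the monic polynomial g^t, the quotient Q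
    has coefficients in (gamma^y) and the remainder r has coefficients in
    (gamma^(y+1)) ([mem_code], [code_decomp]).  Division is a bijection, so
    counting the codewords of weight at most rho amounts to counting pairs
    (Q, r) with rho - n t and min(n t, rho) free coefficients
    ([card_code_bounded]).  As the ideal (gamma^k) has q^(e-k) elements
    ([card_gammaX]), there are

      q^((e-y) (rho - n t) + (e-y-1) min(n t, rho))

    such codewords, with truncated subtraction ([card_code_ball]).  The number
    of codewords of weight rho is the difference of the values at rho and at
    rho - 1; it takes one form for rho <= n t ([RT_count_low]) and another for
    rho > n t ([RT_count_high]).  The four parts are the instances y = e with
    t = 0, y = e-1, t = 0, and y = b-1. *)

(** * Ideals of a finite chain ring *)

Lemma card_fibres (T T' : finType) (f : T -> T') (D : {set T}) k :
  (forall x, x \in D -> #|[set y in D | f y == f x]| = k) ->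
  #|D| = (#|f @: D| * k)%N.
Proof.
move=> fibre; rewrite -sum1_card (partition_big_imset f) /= -sum_nat_const.
apply: eq_bigr => _ /imsetP[x xD ->].
by rewrite sum1_card -(fibre x xD); apply: eq_card => y; rewrite inE.
Qed.

Lemma principal_idealP (R : finComUnitRingType) (g x : R) :
  reflect (exists a, x = a * g) (x \in principal_ideal g).
Proof.
by apply: (iffP imsetP) => [[a _ ->] | [a ->]]; exists a.
Qed.

Lemma principal_idealD (R : finComUnitRingType) (g : R) :
  {in principal_ideal g &, forall x y, x + y \in principal_ideal g}.
Proof.
move=> _ _ /principal_idealP[a ->] /principal_idealP[b ->].
by apply/principal_idealP; exists (a + b); rewrite mulrDl.
Qed.

Lemma principal_idealB (R : finComUnitRingType) (g : R) :
  {in principal_ideal g &, forall x y, x - y \in principal_ideal g}.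
Proof.
move=> _ _ /principal_idealP[a ->] /principal_idealP[b ->].
by apply/principal_idealP; exists (a - b); rewrite mulrBl.
Qed.

Lemma principal_ideal_proper (R : finComUnitRingType) (g : R) :
  g \isn't a GRing.unit -> idealr_closed (principal_ideal g).
Proof.
move=> gNu; split.
- by apply/principal_idealP; exists 0; rewrite mul0r.
- apply: contra gNu => /principal_idealP[a a1].
  by apply/unitrPr; exists a; rewrite mulrC.
move=> a _ _ /principal_idealP[b ->] /principal_idealP[c ->].
by apply/principal_idealP; exists (a * b + c); rewrite mulrDl mulrA.
Qed.

Lemma card_cosets (R : finComUnitRingType) (g : R) :
  #|R| = (#|cosets (principal_ideal g)| * #|principal_ideal g|)%N.
Proof.
have -> : cosets (principal_ideal g) =
    [set [set x + a | a in principal_ideal g] | x in [set: R]].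
  by apply/setP => X; apply/imsetP/imsetP => -[x _ ->]; exists x; rewrite ?inE.
rewrite -cardsT; apply: card_fibres => x _.
rewrite -[RHS](card_imset _ (@addrI _ x)); apply: eq_card => y; rewrite inE in_setT andTb.
have I0 : 0 \in principal_ideal g by apply/principal_idealP; exists 0; rewrite mul0r.
apply/eqP/imsetP => [yx | [a aI ->]].
  have: y \in [set y + a | a in principal_ideal g] by apply/imsetP; exists 0; rewrite ?addr0.
  by rewrite yx => /imsetP[a aI ->]; exists a.
apply/setP => z; apply/imsetP/imsetP => -[b bI ->].
  by exists (a + b); rewrite ?addrA ?principal_idealD.
by exists (b - a); rewrite ?principal_idealB // -addrA [a + _]addrC subrK.
Qed.

Lemma card_principal_ideal1 (R : finComUnitRingType) :
  #|principal_ideal (1 : R)| = #|R|.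
Proof.
rewrite -[RHS]cardsT; apply: eq_card => x; rewrite in_setT.
by apply/principal_idealP; exists x; rewrite mulr1.
Qed.

(** Translation by 1 permutes the ring, so it preserves the sum of all elements. *)
Lemma natr_card_eq0 (R : finComUnitRingType) : #|R|%:R = 0 :> R.
Proof.
have: \sum_(x : R) x = \sum_(x : R) (x + 1) by rewrite (reindex_inj (addIr 1)).
by rewrite big_split /= sumr_const -[LHS]addr0 => /addrI/esym.
Qed.

Section ChainRing.

Variables (R : finComUnitRingType) (gamma : R) (e : nat).
Hypothesis R_chain : chain_ring R.
Hypothesis gamma_max : maximal_ideal (principal_ideal gamma).
Hypothesis gamma_nilp : nilpotency_index gamma e.

(** Ideals being totally ordered, the ideal of a nonunit lies below the
    maximal ideal or, containing it, is equal to it. *)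
Lemma unit_outside_max a : a \notin principal_ideal gamma -> a \is a GRing.unit.
Proof.
apply: contraR => /principal_ideal_proper a_ideal.
have aI : a \in principal_ideal a by apply/principal_idealP; exists 1; rewrite mul1r.
have [gamma_ideal gamma_maxP] := gamma_max.
have /orP[le | le] := R_chain a_ideal gamma_ideal; first exact: (subsetP le).
by rewrite -(gamma_maxP _ a_ideal le).
Qed.

Lemma gammaX_mul_eq0 k a :
  (k < e)%N -> a * gamma ^+ k = 0 -> a \in principal_ideal gamma.
Proof.
move=> lt_ke a0; apply: contraT => /unit_outside_max ua.
have := gamma_nilp.2 k lt_ke.
by rewrite -(mulKr ua (gamma ^+ k)) a0 mulr0 eqxx.
Qed.

(** If x = a gamma^k with k + 1 < e, then a gamma^(k+1) = 0 forces a into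
    (gamma), so the exponent k can be raised until it reaches e - 1. *)
Lemma annihilator_gamma x : x * gamma = 0 -> x \in principal_ideal (gamma ^+ e.-1).
Proof.
move=> x0.
suff: forall k, (k <= e.-1)%N -> x \in principal_ideal (gamma ^+ k) by apply.
elim=> [_ | k IHk lt_ke].
  by apply/principal_idealP; exists x; rewrite mulr1.
have /principal_idealP[a xE] := IHk (ltnW lt_ke).
have: a \in principal_ideal gamma.
  apply: (@gammaX_mul_eq0 k.+1); last by rewrite exprSr mulrA -xE.
  by case: (e) lt_ke.
case/principal_idealP=> b aE.
by apply/principal_idealP; exists b; rewrite xE aE exprS mulrA.
Qed.

Lemma principal_idealX_le j k :
  (j <= k)%N -> principal_ideal (gamma ^+ k) \subset principal_ideal (gamma ^+ j).
Proof.
move=> le_jk; apply/subsetP => _ /principal_idealP[a ->].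
apply/principal_idealP; exists (a * gamma ^+ (k - j)).
by rewrite -mulrA -exprD subnK.
Qed.

(** Multiplication by gamma maps (gamma^k) onto (gamma^(k+1)), and its fibres are
    translates of the annihilator of gamma, which is (gamma^(e-1)). *)
Lemma card_gammaX_step k : (k < e)%N ->
  #|principal_ideal (gamma ^+ k)| =
  (#|principal_ideal (gamma ^+ k.+1)| * #|principal_ideal (gamma ^+ e.-1)|)%N.
Proof.
move=> lt_ke.
have le_ke : (k <= e.-1)%N by case: (e) lt_ke.
have e_gt0 : (0 < e)%N by apply: leq_trans lt_ke.
have imE : [set x * gamma | x in principal_ideal (gamma ^+ k)] =
           principal_ideal (gamma ^+ k.+1).
  apply/setP => x; apply/imsetP/principal_idealP => [[_ /principal_idealP[a ->] ->]|[a ->]].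
    by exists a; rewrite exprSr mulrA.
  by exists (a * gamma ^+ k); [apply/principal_idealP; exists a | rewrite exprSr mulrA].
rewrite -imE; apply: card_fibres => x xI.
rewrite -[RHS](card_imset _ (@addrI _ x)); apply: eq_card => y; rewrite inE.
apply/andP/imsetP => [[yI /eqP yx] | [z zI ->]].
  exists (y - x); last by rewrite addrC subrK.
  by apply: annihilator_gamma; rewrite mulrBl yx subrr.
split.
  have zI' := subsetP (principal_idealX_le le_ke) _ zI.
  exact: principal_idealD.
have /principal_idealP[a ->] := zI.
by rewrite mulrDl -mulrA -exprSr prednK // gamma_nilp.1 mulr0 addr0.
Qed.

(** Each step of the filtration by powers of gamma has the same index, namely
    the order of (gamma^(e-1)); the first step identifies it as the order of
    the residue field. *)
Lemma card_gammaX k :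
  #|principal_ideal (gamma ^+ k)| = (#|cosets (principal_ideal gamma)| ^ (e - k))%N.
Proof.
have card0 j : (e <= j)%N -> #|principal_ideal (gamma ^+ j)| = 1%N.
  move=> le_ej.
  rewrite (_ : principal_ideal _ = [set 0]) ?cards1 //.
  apply/setP => x; rewrite inE -(subnKC le_ej) exprD gamma_nilp.1 mul0r.
  apply/principal_idealP/eqP => [[a ->] | ->]; first by rewrite mulr0.
  by exists 0; rewrite mulr0.
have [e0 | e_gt0] := posnP e.
  by rewrite e0 sub0n expn0 card0 // e0.
have -> : #|cosets (principal_ideal gamma)| = #|principal_ideal (gamma ^+ e.-1)|.
  have:= card_cosets gamma; rewrite -{2}[gamma]expr1.
  rewrite -card_principal_ideal1 -(expr0 gamma).
  rewrite (card_gammaX_step e_gt0) mulnC => /eqP; rewrite eqn_pmul2r => [/eqP -> //|].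
  by apply/card_gt0P; exists 0; apply/principal_idealP; exists 0; rewrite mul0r.
have [d] := ubnP (e - k); elim: d k => // d IHd k lt_d.
have [le_ek | lt_ke] := leqP e k.
  by rewrite card0 //; move: le_ek; rewrite -subn_eq0 => /eqP ->; rewrite expn0.
rewrite card_gammaX_step // IHd ?subnS; last first.
  by rewrite -ltnS prednK ?subn_gt0.
by rewrite -expnSr prednK ?subn_gt0.
Qed.

(** Otherwise p would be a unit, while its power q^e = #|R| vanishes in R. *)
Lemma residue_char_in p m : prime p ->
  #|cosets (principal_ideal gamma)| = (p ^ m)%N -> p%:R \in principal_ideal gamma.
Proof.
move=> p_prime cardE; apply: contraT => /unit_outside_max.
have cardR : #|R| = ((p ^ m) ^ e)%N.
  by rewrite -cardE -[e in RHS]subn0 -card_gammaX expr0 card_principal_ideal1.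
move=> /(unitrX (m * e)); rewrite -natrX expnM -cardR natr_card_eq0.
by rewrite unitr0.
Qed.

End ChainRing.

(** * Binomial powers of prime-power exponent and nilpotent perturbations *)

(** From i C(P, i) = P C(P - 1, i - 1) with P = p^s: if p did not divide C(P, i),
    then P would divide i. *)
Lemma primeX_dvd_bin p s i : prime p -> (0 < i < p ^ s)%N -> (p %| 'C(p ^ s, i))%N.
Proof.
move=> p_prime /andP[i_gt0 lt_i]; apply: contraLR lt_i => pNdvd.
rewrite -leqNgt dvdn_leq // -(@Gauss_dvdl _ _ 'C(p ^ s, i)); last first.
  by rewrite coprimeXl // prime_coprime.
by case: i i_gt0 {pNdvd} => // i _; rewrite -mul_bin_diag dvdn_mulr.
Qed.

(** The factor d in the error term is what makes the perturbation of omega in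
    [base_primeX] nilpotent. *)
Lemma exprD_primeX (A : comNzRingType) (b d : A) p s : prime p ->
  exists K, (b + d) ^+ (p ^ s) = b ^+ (p ^ s) + d ^+ (p ^ s) + p%:R * d * K.
Proof.
move=> p_prime; have : (0 < p ^ s)%N by rewrite expn_gt0 prime_gt0.
case E: (p ^ s)%N => [//|P] _.
exists (\sum_(i < P) b ^+ (P - i) * d ^+ i *+ ('C(P.+1, i.+1) %/ p)).
rewrite exprDn big_ord_recl big_ord_recr /= !bin0 subn0 expr0 mulr1.
rewrite subnn expr0 mul1r binn addrAC addrA; congr (_ + _ + _).
rewrite mulr_sumr; apply: eq_bigr => i _.
rewrite subSS exprS mulrnAr -mulr_natl -[RHS]mulr_natl mulrA mulrA.
rewrite -[in LHS](@divnK p 'C(P.+1, i.+1)) ?natrM; first by ring.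
by rewrite -E primeX_dvd_bin // E /= ltnS.
Qed.

(** A truncated geometric series inverts u + z = u (1 + v z). *)
Lemma unitD_nilpotent (A : comNzRingType) (u v z : A) k :
  u * v = 1 -> z ^+ k = 0 -> exists w, (u + z) * w = 1.
Proof.
move=> uv z0; exists (v * \sum_(i < k) (- (v * z)) ^+ i).
have -> : u + z = u * (1 - - (v * z)) by rewrite opprK mulrDr mulr1 mulrA uv mul1r.
rewrite mulrACA uv mul1r -[1 - _]opprB mulNr -subrX1 exprNn exprMn z0.
by rewrite !mulr0 sub0r opprK.
Qed.

(** * Polynomials with coefficients in an ideal *)

Lemma card_poly_coefs (R : finComNzRingType) (J : {set R}) k : 0 \in J ->
  #|[set c : {poly_k R} | [forall i : 'I_k, c`_i \in J]]| = (#|J| ^ k)%N.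
Proof.
move=> J0.
pose f (c : {poly_k R}) := [ffun i : 'I_k => c`_i].
have f_inj : injective f.
  move=> c c' /ffunP cc'; apply/npolyP => i.
  have [lt_ik | le_ki] := ltnP i k; last by rewrite !big_coef_npoly.
  by have := cc' (Ordinal lt_ik); rewrite !ffunE.
have -> : (#|J| ^ k = #|J| ^ #|'I_k|)%N by rewrite card_ord.
rewrite -(card_imset _ f_inj) -card_ffun_on.
apply: eq_card => u; apply/imsetP/ffun_onP => [[c + ->] i | uJ].
  by rewrite inE ffunE => /forallP.
have size_u : (size (\poly_(i < k) oapp u 0%R (insub i)) <= k)%N by rewrite size_poly.
have coef_u (i : 'I_k) : (\poly_(i < k) oapp u 0%R (insub i))`_i = u i.
  by rewrite coef_poly ltn_ord valK.
exists (npolyp k (\poly_(i < k) oapp u 0%R (insub i))).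
  by rewrite inE; apply/forallP => i; rewrite npolypK // coef_u.
by apply/ffunP => i; rewrite ffunE npolypK // coef_u.
Qed.

Lemma poly_in_principal_ideal (R : finComUnitRingType) (g : R) (c : {poly R}) :
  (forall i, c`_i \in principal_ideal g) -> exists d, c = g *: d.
Proof.
move=> cI; exists (\poly_(i < size c) odflt 0 [pick a | c`_i == a * g]).
apply/polyP => i; rewrite coefZ coef_poly.
have [lt_i | ?] := ltnP; last by rewrite nth_default ?mulr0.
case: pickP => [a /eqP -> | no]; first by rewrite mulrC.
by have /principal_idealP[a ca] := cI i; have := no a; rewrite ca eqxx.
Qed.

Lemma size_monic_exp (A : nzRingType) (g : {poly A}) k :
  g \is monic -> size (g ^+ k) = ((size g).-1 * k).+1.
Proof.
move=> g_monic; elim: k => [|k IHk]; first by rewrite expr0 size_poly1 muln0.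
rewrite exprS size_monicM ?monic_neq0 ?monic_exp // IHk mulnS.
by have := monic_neq0 g_monic; rewrite -size_poly_gt0; lia.
Qed.

(** * The code generated by a power of g *)

Section Code.

Variables (R : finComUnitRingType) (N : nat) (lambda gamma : R).
Variables (g w : {poly R}) (P : nat).

Let h : {poly R} := 'X^N - lambda%:P.

Variable v : {poly %/ h}.
Hypothesis N_gt0 : (0 < N)%N.
Hypothesis g_monic : g \is monic.
Hypothesis gP : g ^+ P = h + gamma%:P * w.
Hypothesis w_inv : in_qpoly h w * v = 1.

Lemma mk_monic_modulus : mk_monic h = h.
Proof. by rewrite /mk_monic size_XnsubC // ltnS N_gt0 monicXnsubC. Qed.

Lemma in_qpoly_modulus : in_qpoly h h = 0.
Proof. by apply/val_inj; rewrite /= mk_monic_modulus rmodpp // monicXnsubC. Qed.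

(** Modulo h, gamma and g^P are associates; this exchange of gamma for powers of g
    is the reason why gamma^(y+1) belongs to the code. *)
Lemma in_qpoly_gamma : in_qpoly h gamma%:P = in_qpoly h g ^+ P * v.
Proof.
by rewrite -rmorphXn gP rmorphD rmorphM /= in_qpoly_modulus add0r -mulrA w_inv mulr1.
Qed.

Section Exponent.

Variables (y t : nat).
Hypothesis le_tP : (t <= P)%N.

Let C := constacyclic_code N lambda (g ^+ (y * P + t)).

Lemma mem_code (Q r : {poly R}) :
  in_qpoly h (gamma ^+ y *: Q * g ^+ t + gamma ^+ y.+1 *: r) \in C.
Proof.
apply/imsetP.
(* Trade gamma^y for g^(y P) v^y in the first term, and gamma^(y+1) for
   g^(y P + P) v^(y+1) in the second, then factor out g^(y P + t). *)
exists (v ^+ y * in_qpoly h Q +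
  in_qpoly h g ^+ (P - t) * v ^+ y.+1 * in_qpoly h r) => //.
rewrite -!mul_polyC !polyC_exp rmorphD !rmorphM !rmorphXn /= !in_qpoly_gamma mulrDl.
have -> : in_qpoly h g ^+ P = in_qpoly h g ^+ (P - t) * in_qpoly h g ^+ t.
  by rewrite -exprD subnK.
rewrite exprD mulnC exprM.
have -> : in_qpoly h g ^+ P = in_qpoly h g ^+ (P - t) * in_qpoly h g ^+ t.
  by rewrite -exprD subnK.
by rewrite -/h !exprS !exprMn; ring.
Qed.

(** Modulo h the codeword is gamma^y d, with d the remainder of w^y a g^t.  As
    h = g^P - gamma w and t <= P, reducing modulo h changes d only by a multiple
    of g^t and a multiple of gamma; dividing the latter by g^t bounds r. *)
Lemma code_decomp (c : ambient N lambda) : c \in C ->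
  exists Q r : {poly R}, (size r < size (g ^+ t))%N /\
    (c : {poly R}) = gamma ^+ y *: Q * g ^+ t + gamma ^+ y.+1 *: r.
Proof.
case/imsetP=> a _ ->.
have gt_monic : g ^+ t \is monic by rewrite monic_exp.
pose B : {poly R} := w ^+ y * (a : {poly R}).
pose K := rdivp (B * g ^+ t) h.
exists (B - K * g ^+ (P - t) + gamma *: rdivp (K * w) (g ^+ t)).
exists (rmodp (K * w) (g ^+ t)).
split; first by rewrite ltn_rmodpN0 // monic_neq0.
have -> : a * in_qpoly h (g ^+ (y * P + t)) = gamma ^+ y *: in_qpoly h (B * g ^+ t).
  have aE : in_qpoly h a = a by apply/val_inj/in_qpoly_small/size_mk_monic.
  have gE : in_qpoly h g ^+ P = in_qpoly h gamma%:P * in_qpoly h w.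
    by rewrite -rmorphXn gP rmorphD /= in_qpoly_modulus add0r rmorphM.
  rewrite -/h -{1}aE -in_qpolyZ -mul_polyC polyC_exp.
  rewrite !rmorphM !rmorphXn /= exprD mulnC exprM gE exprMn.
  by ring.
have -> : (gamma ^+ y *: in_qpoly h (B * g ^+ t) : {poly R}) =
    gamma ^+ y *: rmodp (B * g ^+ t) h by rewrite /= mk_monic_modulus.
have h_monic : h \is monic by rewrite monicXnsubC.
have -> : rmodp (B * g ^+ t) h = B * g ^+ t - K * h.
  by rewrite [X in X - _](rdivp_eq h_monic) addrC addKr.
have hE : h = g ^+ (P - t) * g ^+ t - gamma%:P * w.
  by rewrite -exprD subnK // gP addrK.
have KwE := rdivp_eq gt_monic (K * w).
rewrite exprSr -scalerA -scalerAl -scalerDr; congr (_ *: _).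
rewrite {1}hE -!mul_polyC.
transitivity (B * g ^+ t - K * g ^+ (P - t) * g ^+ t + gamma%:P * (K * w)).
  by ring.
by rewrite {1}KwE; ring.
Qed.

(** Division by g^t identifies codewords of weight at most rho with pairs
    (quotient, remainder); uniqueness of the division gives injectivity. *)
Lemma card_code_bounded rho : (rho <= N)%N ->
  #|[set c in C | (RT_weight c <= rho)%N]| =
  (#|principal_ideal (gamma ^+ y)| ^ (rho - (size g).-1 * t) *
   #|principal_ideal (gamma ^+ y.+1)| ^ minn ((size g).-1 * t) rho)%N.
Proof.
move=> le_rhoN; set d := ((size g).-1 * t)%N.
have gt_monic : g ^+ t \is monic by rewrite monic_exp.
have size_gt : size (g ^+ t) = d.+1 by rewrite size_monic_exp.
have I0 k : 0 \in principal_ideal (gamma ^+ k).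
  by apply/principal_idealP; exists 0; rewrite mul0r.
rewrite -!card_poly_coefs // -cardsX.
(* When rho <= d the first factor is the zero module and c is all remainder. *)
pose F (u : {poly_(rho - d) R} * {poly_(minn d rho) R}) :=
  in_qpoly h ((u.1 : {poly R}) * g ^+ t + (u.2 : {poly R})).
have size2 (u : {poly_(minn d rho) R}) : (size u < size (g ^+ t))%N.
  by rewrite size_gt ltnS (leq_trans (size_npoly u)) // geq_minl.
have size_F (u : {poly_(rho - d) R} * {poly_(minn d rho) R}) :
    (size ((u.1 : {poly R}) * g ^+ t + (u.2 : {poly R}))%R <= rho)%N.
  rewrite (leq_trans (size_polyD _ _)) // geq_max.
  rewrite (leq_trans (size_npoly u.2) (geq_minr _ _)) andbT.
  have [-> | u0] := eqVneq (u.1 : {poly R}) 0; first by rewrite mul0r size_poly0.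
  rewrite (leq_trans (size_polyMleq _ _)) // size_gt.
  by have := size_npoly u.1; move: u0; rewrite -size_poly_gt0; lia.
have valF u : (F u : {poly R}) = (u.1 : {poly R}) * g ^+ t + (u.2 : {poly R}).
  apply: in_qpoly_small; rewrite mk_monic_modulus size_XnsubC // ltnS.
  exact: leq_trans (size_F u) le_rhoN.
have F_inj : injective F.
  move=> [u1 u2] [u1' u2'] /(congr1 (fun c : {poly %/ h} => (c : {poly R}))).
  rewrite !valF /= => E.
  congr (_, _); apply/val_inj => /=.
    by rewrite -(rdivp_addl_mul_small gt_monic u1 (size2 u2)) E rdivp_addl_mul_small.
  by rewrite -(rmodp_addl_mul_small gt_monic u1 (size2 u2)) E rmodp_addl_mul_small.
rewrite -(card_imset _ F_inj); apply: eq_card => c; rewrite inE.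
apply/andP/imsetP => [[cC c_le] | [[u1 u2] + ->]].
  have [Q [r [size_r cE]]] := code_decomp cC.
  have size_r' : (size (gamma ^+ y.+1 *: r)%R < size (g ^+ t))%N.
    exact: leq_ltn_trans (size_scale_leq _ _) size_r.
  have size_c : (size (c : {poly R}) <= rho)%N := c_le.
  have size_QG : (size (gamma ^+ y *: Q)%R <= rho - d)%N /\
                 (size (gamma ^+ y.+1 *: r)%R <= minn d rho)%N.
    move: size_c size_r'; rewrite cE size_gt ltnS => size_c size_r'.
    have [Q0 | Q0] := eqVneq (gamma ^+ y *: Q) 0.
      move: size_c; rewrite Q0 mul0r add0r size_poly0 => size_c.
      by rewrite leq_min size_r' size_c.
    have sizeM : size (gamma ^+ y *: Q * g ^+ t) = (size (gamma ^+ y *: Q)%R + d)%N.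
      by rewrite size_Mmonic // size_gt addnS.
    have Q_gt0 : (0 < size (gamma ^+ y *: Q)%R)%N by rewrite size_poly_gt0.
    by move: size_c; rewrite size_polyDl sizeM; lia.
  exists (npolyp _ (gamma ^+ y *: Q), npolyp _ (gamma ^+ y.+1 *: r)).
    rewrite !inE /=; apply/andP; split; apply/forallP => i.
      by rewrite npolypK ?size_QG.1 // coefZ; apply/principal_idealP; exists Q`_i; rewrite mulrC.
    by rewrite npolypK ?size_QG.2 // coefZ; apply/principal_idealP; exists r`_i; rewrite mulrC.
  by apply/val_inj; rewrite [RHS]valF /= !npolypK ?size_QG.1 ?size_QG.2.
rewrite in_setX !inE /= => /andP[/forallP u1I /forallP u2I].
split; last by rewrite /RT_weight valF size_F.
have coefI k J (u : {poly_k R}) : (0 \in J) -> (forall i : 'I_k, u`_i \in J) ->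
    forall i, u`_i \in J.
  move=> J0 uJ i; have [lt_ik | le_ki] := ltnP i k; first exact: (uJ (Ordinal lt_ik)).
  by rewrite big_coef_npoly.
have [Q QE] := poly_in_principal_ideal (coefI _ _ _ _ (I0 y) u1I).
have [r rE] := poly_in_principal_ideal (coefI _ _ _ _ (I0 y.+1) u2I).
by rewrite /F /= QE rE mem_code.
Qed.

End Exponent.
End Code.

(** * Weight distribution *)

Lemma RT_count_ballS (R : finComUnitRingType) N (lambda : R)
    (C : {set ambient N lambda}) k :
  #|[set c in C | (RT_weight c <= k.+1)%N]| =
  (RT_count C k.+1 + #|[set c in C | (RT_weight c <= k)%N]|)%N.
Proof.
rewrite -(cardsID [set c | RT_weight c == k.+1]); congr (_ + _)%N;
  apply: eq_card => c; rewrite !inE leq_eqVlt; case: (c \in C) => //=;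
  lia.
Qed.

Lemma RT_count0_ball (R : finComUnitRingType) N (lambda : R)
    (C : {set ambient N lambda}) :
  RT_count C 0 = #|[set c in C | (RT_weight c <= 0)%N]|.
Proof. by apply: eq_card => c; rewrite !inE leqn0. Qed.

Section Weights.

Variables (R : finComUnitRingType) (gamma lambda lambda0 omega : R).
Variables (e p m n s : nat).
Hypothesis R_chain : chain_ring R.
Hypothesis gamma_max : maximal_ideal (principal_ideal gamma).
Hypothesis gamma_nilp : nilpotency_index gamma e.
Hypothesis p_prime : prime p.
Hypothesis residue_card : #|cosets (principal_ideal gamma)| = (p ^ m)%N.
Hypothesis n_gt0 : (0 < n)%N.
Hypothesis omega_unit : omega \is a GRing.unit.
Hypothesis lambdaE : lambda = lambda0 ^+ (p ^ s) + gamma * omega.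

Let N := (n * p ^ s)%N.
Let g : {poly R} := 'X^n - lambda0%:P.
Let h : {poly R} := 'X^N - lambda%:P.

Lemma N_gt0 : (0 < N)%N.
Proof. by rewrite muln_gt0 n_gt0 expn_gt0 prime_gt0. Qed.

(** The congruence between g^(p^s) and a multiple of gamma by an invertible
    element.  Here p = c gamma and w = omega - c g K, with K from [exprD_primeX]. *)
Lemma base_primeX : exists w : {poly R}, g ^+ (p ^ s) = h + gamma%:P * w /\
  exists v, in_qpoly h w * v = 1.
Proof.
have /principal_idealP[c pE] :=
  residue_char_in R_chain gamma_max gamma_nilp p_prime residue_card.
have [K KE] := exprD_primeX lambda0%:P g s p_prime.
exists (omega%:P - c%:P * g * K).
have gP : g ^+ (p ^ s) = h + gamma%:P * (omega%:P - c%:P * g * K).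
  have XN : 'X^N = (lambda0%:P + g) ^+ (p ^ s).
    by rewrite /g /N addrC subrK exprM.
  rewrite /h lambdaE XN KE polyCD polyCM polyC_exp -polyC_natr pE polyCM.
  by ring.
split=> //.
have h0 : in_qpoly h h = 0 := in_qpoly_modulus lambda N_gt0.
have g_nil : in_qpoly h g ^+ (p ^ s * e) = 0.
  rewrite exprM -rmorphXn gP rmorphD /= h0 add0r -rmorphXn exprMn.
  by rewrite -polyC_exp gamma_nilp.1 mul0r rmorph0.
have ou : in_qpoly h omega%:P * in_qpoly h (omega^-1)%:P = 1.
  by rewrite -rmorphM -polyCM mulrV // rmorph1.
rewrite rmorphB /=.
apply: (@unitD_nilpotent _ _ _ _ (p ^ s * e)) ou _.
by rewrite !rmorphM /= mulrAC exprNn exprMn g_nil !mulr0.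
Qed.

Lemma card_code_ball y t rho : (t <= p ^ s)%N -> (rho <= N)%N ->
  #|[set c in constacyclic_code N lambda (g ^+ (y * p ^ s + t)) |
     (RT_weight c <= rho)%N]| =
  ((p ^ m) ^ ((e - y) * (rho - n * t) + (e - y.+1) * minn (n * t) rho))%N.
Proof.
move=> le_t le_rho; have [w [gP [v wv]]] := base_primeX.
have g_monic : g \is monic by rewrite monicXnsubC.
rewrite (card_code_bounded N_gt0 g_monic gP wv) //.
rewrite !(card_gammaX R_chain gamma_max gamma_nilp) residue_card.
by rewrite size_XnsubC //= expnD !expnM.
Qed.

Variables (y t : nat).
Hypothesis le_t : (t <= p ^ s)%N.
Let A := RT_count (constacyclic_code N lambda (g ^+ (y * p ^ s + t))).

Lemma RT_count_zero : A 0 = 1%N.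
Proof. by rewrite /A RT_count0_ball card_code_ball // sub0n minn0 !muln0. Qed.

(** All of c is its own remainder modulo g^t when rho <= n t, so every coefficient
    ranges over (gamma^(y+1)). *)
Lemma RT_count_low rho : (0 < rho <= N)%N -> (rho <= n * t)%N ->
  A rho = ((p ^ (m * (e - y.+1)) - 1) * p ^ (m * (e - y.+1) * (rho - 1)))%N.
Proof.
case: rho => // k /= lt_kN lt_knt.
have := RT_count_ballS (constacyclic_code N lambda (g ^+ (y * p ^ s + t))) k.
rewrite -/A card_code_ball // card_code_ball ?(ltnW lt_kN) //.
have -> : (k.+1 - n * t = 0)%N by lia.
have -> : (k - n * t = 0)%N by lia.
rewrite (minn_idPr lt_knt) (minn_idPr (ltnW lt_knt)) !muln0 !add0n subSS subn0.
rewrite mulnS expnD -!expnM !mulnA => /(congr1 (subn^~ (p ^ (m * (e - y.+1) * k))%N)).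
by rewrite /= addnK mulnBl mul1n => <-.
Qed.

(** Only the quotient gains a coefficient between rho - 1 and rho; that
    coefficient ranges over (gamma^y). *)
Lemma RT_count_high rho : (n * t < rho <= N)%N ->
  A rho = ((p ^ (m * (e - y)) - 1) *
           p ^ (m * ((e - y) * (rho - 1 - n * t) + (e - y.+1) * (n * t))))%N.
Proof.
case: rho => // k /andP[]; rewrite ltnS => le_ntk lt_kN.
have := RT_count_ballS (constacyclic_code N lambda (g ^+ (y * p ^ s + t))) k.
rewrite -/A card_code_ball // card_code_ball ?(ltnW lt_kN) //.
rewrite (minn_idPl (leqW le_ntk)) (minn_idPl le_ntk) (subn1 k.+1) /= subSn //.
rewrite mulnS -addnA expnD -!expnM.
set X := (m * (_ + _))%N => /(congr1 (subn^~ (p ^ X)%N)).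
by rewrite /= addnK mulnBl mul1n => <-.
Qed.

End Weights.

Theorem theorem4p4 (R : finComUnitRingType) (gamma zeta lambda lambda0 omega : R)
    (e p m n s : nat)
    (e_ge2 : (2 <= e)%N)
    (R_chain : chain_ring R)
    (gamma_max : maximal_ideal (principal_ideal gamma))
    (gamma_nilp : nilpotency_index gamma e)
    (p_prime : prime p)
    (residue_card : #|cosets (principal_ideal gamma)| = (p ^ m)%N)
    (zeta_order : ((p ^ m).-1)%N.-primitive_root zeta)
    (n_gt0 : (0 < n)%N)
    (s_gt0 : (0 < s)%N)
    (n_coprime_p : coprime n p)
    (lambda0_teich : lambda0 \in teichmuller (p ^ m) zeta)
    (lambda0_neq0 : lambda0 != 0)
    (irr : poly_irreducible ('X^n - lambda0%:P))
    (omega_unit : omega \is a GRing.unit)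
    (lambdaE : lambda = lambda0 ^+ (p ^ s) + gamma * omega)
    (lambda_unit : lambda \is a GRing.unit)
    (nu : nat)
    (nu_le : (nu <= e * p ^ s)%N) :
  let A := RT_count
    (constacyclic_code (n * p ^ s) lambda (('X^n - lambda0%:P) ^+ nu)) in
  [/\ (* (a) *)
      nu = (e * p ^ s)%N ->
      A 0%N = 1%N /\
      (forall rho, (1 <= rho <= n * p ^ s)%N -> A rho = 0%N),
      (* (b) *)
      ((e - 1) * p ^ s + 1 <= nu <= e * p ^ s - 1)%N ->
      [/\ A 0%N = 1%N,
          forall rho, (1 <= rho <= n * nu - n * (e - 1) * p ^ s)%N ->
            A rho = 0%N
        & forall rho,
            (n * nu - n * (e - 1) * p ^ s + 1 <= rho <= n * p ^ s)%N ->
            A rho =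
            ((p ^ m - 1) * p ^ (m * (rho + n * (e - 1) * p ^ s - n * nu - 1)))%N],
      (* (c) *)
      forall y, (y <= e - 1)%N -> nu = (y * p ^ s)%N ->
      A 0%N = 1%N /\
      (forall rho, (1 <= rho <= n * p ^ s)%N ->
         A rho = ((p ^ (m * (e - y)) - 1) * p ^ (m * (e - y) * (rho - 1)))%N)
    & (* (d) *)
      forall b, (1 <= b <= e - 1)%N ->
      ((b - 1) * p ^ s + 1 <= nu <= b * p ^ s - 1)%N ->
      [/\ A 0%N = 1%N,
          forall rho, (1 <= rho <= n * nu - n * (b - 1) * p ^ s)%N ->
            A rho = ((p ^ (m * (e - b)) - 1) * p ^ (m * (e - b) * (rho - 1)))%N
        & forall rho,
            (n * nu - n * (b - 1) * p ^ s + 1 <= rho <= n * p ^ s)%N ->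
            (* the first exponent is negative, hence the rationals *)
            (A rho)%:R =
            (p%:R : rat) ^ (m%:Z * ((n * p ^ s)%:Z * (b%:Z - 1) - (n * nu)%:Z
                                    - e%:Z + b%:Z - 1))
            * (p%:R ^+ (m * (e - b + 1)) - 1) * p%:R ^+ (m * (e - b + 1) * rho)]].
Proof.
move=> A.
have count_0 y t : nu = (y * p ^ s + t)%N -> (t <= p ^ s)%N -> A 0%N = 1%N.
  by move=> nuE le_t; rewrite /A nuE (RT_count_zero R_chain gamma_max gamma_nilp p_prime
    residue_card n_gt0 omega_unit lambdaE).
have count_low y t rho : nu = (y * p ^ s + t)%N -> (t <= p ^ s)%N ->
    (0 < rho <= n * p ^ s)%N -> (rho <= n * t)%N ->
    A rho = ((p ^ (m * (e - y.+1)) - 1) * p ^ (m * (e - y.+1) * (rho - 1)))%N.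
  by move=> nuE le_t; rewrite /A nuE;
    apply: (RT_count_low R_chain gamma_max gamma_nilp p_prime
    residue_card n_gt0 omega_unit lambdaE).
have count_high y t rho : nu = (y * p ^ s + t)%N -> (t <= p ^ s)%N ->
    (n * t < rho <= n * p ^ s)%N ->
    A rho = ((p ^ (m * (e - y)) - 1) *
             p ^ (m * ((e - y) * (rho - 1 - n * t) + (e - y.+1) * (n * t))))%N.
  by move=> nuE le_t; rewrite /A nuE;
    apply: (RT_count_high R_chain gamma_max gamma_nilp p_prime
    residue_card n_gt0 omega_unit lambdaE).
have shift y : (y * p ^ s <= nu)%N ->
    nu = (y * p ^ s + (nu - y * p ^ s))%N /\
    (n * nu - n * y * p ^ s = n * (nu - y * p ^ s))%N.
  by move=> le_nu; rewrite subnKC // mulnBr mulnA.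
have ps_gt0 : (0 < p ^ s)%N by rewrite expn_gt0 prime_gt0.
split.
(* The ideal (gamma^e) is zero, so the zero word is the only one. *)
- move=> nuE; have nuE' : nu = (e * p ^ s + 0)%N by rewrite addn0.
  split=> [|rho rhoP]; first exact: count_0 nuE' _.
  by rewrite (count_high _ _ _ nuE') ?muln0 // subnn muln0.
- move=> nuP.
  have eP : (e * p ^ s = (e - 1) * p ^ s + p ^ s)%N.
    by rewrite mulnBl mul1n subnK // leq_pmull; lia.
  have [|nuE tE] := shift (e - 1)%N; first by lia.
  have le_t : (nu - (e - 1) * p ^ s <= p ^ s)%N by lia.
  split; first exact: count_0 nuE le_t.
  + move=> rho; rewrite tE => rhoP.
    rewrite (count_low _ _ _ nuE) //; last by lia.
      by rewrite (_ : e - (e - 1).+1 = 0)%N ?muln0 //; lia.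
    by rewrite (leq_trans _ (leq_mul (leqnn n) le_t)); lia.
  move=> rho; rewrite tE => rhoP.
  rewrite (count_high _ _ _ nuE) //; last by lia.
  have -> : (e - (e - 1) = 1)%N by lia.
  have -> : (e - (e - 1).+1 = 0)%N by lia.
  rewrite muln1 mul1n mul0n addn0; congr (_ * p ^ (m * _))%N.
  lia.
- move=> y le_y nuE; have nuE' : nu = (y * p ^ s + 0)%N by rewrite addn0.
  split=> [|rho rhoP]; first exact: count_0 nuE' _.
  by rewrite (count_high _ _ _ nuE') ?muln0 // addn0 subn0 mulnA.
move=> b bP nuP.
have bE : (b * p ^ s = (b - 1) * p ^ s + p ^ s)%N.
  by rewrite mulnBl mul1n subnK // leq_pmull; lia.
have [|nuE tE] := shift (b - 1)%N; first by lia.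
have le_t : (nu - (b - 1) * p ^ s <= p ^ s)%N by lia.
split; first exact: count_0 nuE le_t.
- move=> rho; rewrite tE => rhoP.
  rewrite (count_low _ _ _ nuE) //; last by lia.
    by rewrite (_ : e - (b - 1).+1 = e - b)%N //; lia.
  by rewrite (leq_trans _ (leq_mul (leqnn n) le_t)); lia.
move=> rho; rewrite tE => rhoP.
rewrite (count_high _ _ _ nuE) //; last by lia.
set T := (nu - _)%N in nuE tE le_t rhoP *.
have [k kE] : exists k, (e = k + (b - 1) /\ e - b + 1 = k /\ e - (b - 1) = k)%N.
  by exists (e - b + 1)%N; lia.
have [u uE] : exists u, rho = (n * T + 1 + u)%N by exists (rho - (n * T + 1))%N; lia.
have p_neq0 : p%:R != 0 :> rat by rewrite Num.Theory.pnatr_eq0 -lt0n prime_gt0.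
case: kE => eE [-> ->].
have -> : (rho - 1 - n * T = u)%N by rewrite uE; lia.
have -> : (e - (b - 1).+1 = k - 1)%N by lia.
have k_gt0 : (0 < k)%N by lia.
rewrite natrM natrB ?expn_gt0 ?prime_gt0 // !natrX mulrAC [RHS]mulrC.
congr (_ * _); rewrite !exprnP -expfzDr //.
(* Removing the subtractions from b and k makes the exponents polynomial
   expressions, which can be compared in the integers. *)
have [c bc] : exists c, b = c.+1 by exists (b - 1)%N; lia.
have [j kj] : exists j, k = j.+1 by exists (k - 1)%N; lia.
congr (_ ^ _); rewrite {}uE nuE {}eE {}bc {}kj !subn1 /=; lia.
Qed.
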